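(* For integers $n\ge2$, $$D_n(s,t,q)=\begin{cases}q^{n(n-1)}s^{k}t^{k+1}D_n(s^{-1},t^{-1},q^{-1})&\text{when } n=2k+1,\\ q^{n(n-1)}s^{k-1}t^{k+1}D_n(s^{-1},t^{-1},q^{-1})&\text{when } n=2k.\end{cases}$$
   Context: $\mathfrak{B}_n$ is the group of permutations $w$ of $\{\pm1,\dots,\pm n\}$ with $w(-i)=-w(i)$, written $w=w_1,\dots,w_n$ with $w_i=w(i)$; $\mathfrak{D}_n\subseteq\mathfrak{B}_n$ is the subgroup of those $w$ with an even number of negative entries among $w_1,\dots,w_n$. For $w\in\mathfrak{D}_n$ set $w_{-1}=-w_1$; an index $i\in\{-1,1,2,\dots,n-1\}$ is a descent if $w_i>w_{|i|+1}$ (so $-1$ is a descent iff $-w_1>w_2$). $\mathrm{odes}_D(w)$ (resp. $\mathrm{edes}_D(w)$) is the number of odd (resp. even) descents; the index $-1$ is odd. $\mathrm{inv}_D(w)=|\{1\le i<j\le n:w_i>w_j\}|+|\{1\le i<j\le n:-w_i>w_j\}|$. $D_n(s,t,q)=\sum_{w\in\mathfrak{D}_n}s^{\mathrm{edes}_D(w)}t^{\mathrm{odes}_D(w)}q^{\mathrm{inv}_D(w)}$. *)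

(* Defs.v *)
From mathcomp Require Import all_boot all_order all_algebra all_fingroup.

Set Implicit Arguments.
Unset Strict Implicit.
Unset Printing Implicit Defensive.

Import Order.TTheory GRing.Theory Num.Theory.
Local Open Scope ring_scope.

(* The set {1, -1, ..., n, -n}: the pair (b, i) stands for the integer
   (-1)^b * (i + 1). *)
Notation letter n := (bool * 'I_n)%type.

Definition lval (n : nat) (x : letter n) : int := (-1) ^+ x.1 * (x.2.+1)%:Z.

Definition lneg (n : nat) (x : letter n) : letter n := (~~ x.1, x.2).

Definition Bgrp (n : nat) : {set {perm letter n}} :=
  [set w : {perm letter n} | [forall x, w (lneg x) == lneg (w x)]].

(* entry w i is w(i) for an integer i with 1 <= |i| <= n; the value 0 outside
   this range is never used.  In particular entry w (-1) is w(-1) = - w_1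
   when w is in B_n, see entryN. *)
Definition entry (n : nat) (w : {perm letter n}) (i : int) : int :=
  if [pick x : letter n | lval x == i] is Some x then lval (w x) else 0.

Definition nneg (n : nat) (w : {perm letter n}) : nat :=
  count (fun i : nat => entry w i%:Z < 0) (iota 1 n).

Definition Dgrp (n : nat) : {set {perm letter n}} :=
  [set w in Bgrp n | ~~ odd (nneg w)].

Definition Dindices (n : nat) : seq int :=
  -1 :: [seq i%:Z | i <- iota 1 n.-1].

Definition Ddescent (n : nat) (w : {perm letter n}) (i : int) : bool :=
  entry w (`|i|%N.+1)%:Z < entry w i.

Definition odesD (n : nat) (w : {perm letter n}) : nat :=
  count (fun i : int => odd `|i|%N && Ddescent w i) (Dindices n).

Definition edesD (n : nat) (w : {perm letter n}) : nat :=
  count (fun i : int => ~~ odd `|i|%N && Ddescent w i) (Dindices n).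

Definition invD (n : nat) (w : {perm letter n}) : nat :=
  (#|[set p : 'I_n.+1 * 'I_n.+1 |
       (0 < p.1 < p.2) && (entry w p.2%:Z < entry w p.1%:Z)%R]| +
   #|[set p : 'I_n.+1 * 'I_n.+1 |
       (0 < p.1 < p.2) && (entry w p.2%:Z < - entry w p.1%:Z)%R]|)%N.

(* The value at s, t, q of the generating polynomial D_n. Keeping the ring
   arbitrary allows s, t, q to be indeterminates (of a Laurent polynomial ring
   or a rational function field, so that they are invertible). *)
Definition Dpoly (R : comUnitRingType) (n : nat) (s t q : R) : R :=
  \sum_(w in Dgrp n) s ^+ edesD w * t ^+ odesD w * q ^+ invD w.

Lemma lval_inj (n : nat) : injective (@lval n).
Proof.
move=> [b i] [c j]; rewrite /lval /= => e.
have /(congr1 absz) := e; rewrite !abszMsign => -[/ord_inj ij].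
by move: e; rewrite ij; case: b c => [] [].
Qed.

Lemma lval_neg (n : nat) (x : letter n) : lval (lneg x) = - lval x.
Proof. by rewrite /lval /= signrN mulNr. Qed.

Lemma entry_lval (n : nat) (w : {perm letter n}) (x : letter n) :
  entry w (lval x) = lval (w x).
Proof.
rewrite /entry; case: pickP => [y /eqP /lval_inj -> //|/(_ x)].
by rewrite eqxx.
Qed.

Lemma entryN (n : nat) (w : {perm letter n}) (i : int) :
  w \in Bgrp n -> entry w (- i) = - entry w i.
Proof.
rewrite inE => /forallP wB.
case: (pickP (fun x : letter n => lval x == i)) => [x /eqP <-|no].
  by rewrite -lval_neg !entry_lval (eqP (wB x)) lval_neg.
have no' (x : letter n) : (lval x == - i) = false.
  by rewrite -eqr_oppLR -lval_neg no.
rewrite /entry; case: pickP => [x|_]; first by rewrite no'.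
by case: pickP => [x|_]; rewrite ?no ?oppr0.
Qed.

(* Main.v *)
Require Import Defs.
From mathcomp Require Import all_boot all_order all_algebra all_fingroup.
From mathcomp Require Import zify ring.

Import GRing.Theory.
Local Open Scope ring_scope.

(** The symmetry comes from right multiplication by the longest element [w0]
of D_n, that is [w |-> w \o w0] (written [w0 n * w], since permutations compose
from left to right). This is an involution of D_n that replaces every entry of
[w] by its opposite, except that the first entry is kept when [n] is odd;
without this exception the number of negative entries would change by [n], and
[w] would leave D_n.

Reversing the signs of both entries of a pair [w_i, w_j] with [i < j] turns
each of the inequalities [w_i > w_j] and [- w_i > w_j] into its negation.
Reversing only the sign of [w_j] negates the two inequalities and exchanges
them. In both cases exactly two of the four inequalities for [w] and
[w \o w0] hold, because [w_i] is neither [w_j] nor [- w_j]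
(lemma [opp_pair_count]). Summing over all
pairs, the inversion numbers of [w] and [w \o w0] add up to [n (n - 1)]
([invD_w0]). Applying the same count to the pair [w_1, w_2] shows that the
indices [-1] and [1], which are both odd, contribute two descents to [w] and
[w \o w0] together, and each index [i >= 2] is a descent of exactly one of
them. Hence the numbers of odd (even) descents add up to the number of odd
(even) indices ([odesD_w0], [edesD_w0]). Each term of the sum over D_n is
therefore the monomial of the symmetry times the inverse of the term of
[w \o w0]. *)

(** * Counting *)

Lemma count_pred_compl (T : eqType) (p a b : pred T) (r : seq T) :
  {in r, forall x, b x = ~~ a x} ->
  (count (fun x => p x && a x) r + count (fun x => p x && b x) r)%N = count p r.
Proof.
elim: r => //= x r IH ab; rewrite -IH; last first.
  by move=> y yr; apply: ab; rewrite inE yr orbT.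
rewrite (ab x) ?mem_head //.
by case: (p x) (a x) => [] []; lia.
Qed.

Lemma count_odd_iota m : count odd (iota 1 m) = uphalf m.
Proof.
elim: m => // m IH; rewrite -(addn1 m) iotaD count_cat IH /=; lia.
Qed.

Lemma count_even_iota m : count (fun i => ~~ odd i) (iota 1 m) = m./2.
Proof.
have := count_predC odd (iota 1 m); rewrite count_odd_iota size_iota /=.
rewrite (eq_count (a2 := fun i => ~~ odd i)) //; lia.
Qed.

(** The pairs are counted by their larger member [j], which has [j - 1]
smaller partners. *)
Lemma card_pos_pairs n :
  #|[set p : 'I_n.+1 * 'I_n.+1 | 0 < p.1 < p.2]%N| = 'C(n, 2).
Proof.
rewrite -sum1dep_card.
(* Swapping the components makes [j] the outer summation index. *)
rewrite (reindex_inj (h := fun p : 'I_n.+1 * 'I_n.+1 => (p.2, p.1))) /=; last first.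
  by move=> [a b] [c d] [-> ->].
rewrite -(pair_big_dep predT (fun j i : 'I_n.+1 => 0 < i < j)%N (fun _ _ => 1%N)) /=.
(* The value [0] of [j] has no partner, and [lift ord0 j] has the value [j + 1]. *)
rewrite big_ord_recl big1 ?add0n => [|i]; last by case: (nat_of_ord i).
rewrite -bin2_sum big_mkord; apply: eq_bigr => j _ /=.
rewrite sum1dep_card.
rewrite -[RHS](card_ord j).
rewrite -(card_imset _ (f := fun i : 'I_j => lift ord0 (widen_ord (ltnW (ltn_ord j)) i))).
  apply: eq_card => i; rewrite !inE; apply/idP/imsetP => [|[k _ ->]]; last first.
    by rewrite /= /bump /= !add1n ltnS ltn_ord.
  rewrite /bump /= add1n => /andP[i0 ij].
  have ij' : (i.-1 < j)%N by lia.
  exists (Ordinal ij') => //; apply: val_inj => /=; rewrite /bump /=; lia.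
by move=> a b /lift_inj /(congr1 val) /= /val_inj.
Qed.

(** [(-1) ^+ e * a] is [a] or [- a], so for either [e] the second sum compares
[- b] with [a] and [- a]. Taking opposites, it counts which of [- a] and [a]
lie strictly below [b], and the first sum counts which of them lie strictly
above [b]. *)
Lemma opp_pair_count (a b : int) (e : bool) : a != b -> a != - b ->
  ((b < a)%R + (b < - a)%R +
   ((- b < (-1) ^+ e * a)%R + (- b < - ((-1) ^+ e * a))%R))%N = 2%N.
Proof. by case: e; rewrite ?expr1 ?expr0 ?mulN1r ?mul1r ?opprK; lia. Qed.

(** * Entries of signed permutations *)

Lemma lval_pos n i : (0 < i <= n)%N ->
  exists2 x : letter n, lval x = i%:Z & x.2.+1 = i.
Proof.
case: i => // i lt_in; exists (false, Ordinal lt_in) => //.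
by rewrite /lval /= expr0 mul1r.
Qed.

Lemma entry_neq0 n (w : {perm letter n}) i : (0 < i <= n)%N ->
  entry w i%:Z != 0.
Proof.
move=> /lval_pos[x <- _]; rewrite entry_lval /lval.
by case: (w x) => [[] k]; rewrite ?expr1 ?expr0 ?mulN1r ?mul1r; lia.
Qed.

Lemma entry_neq n (w : {perm letter n}) i j : (0 < i < j)%N -> (j <= n)%N ->
  entry w i%:Z != entry w j%:Z.
Proof.
move=> ij jn.
have /lval_pos[x xi xi2] : (0 < i <= n)%N by lia.
have /lval_pos[y yj yj2] : (0 < j <= n)%N by lia.
rewrite -xi -yj !entry_lval; apply/eqP => /lval_inj /perm_inj xy.
by move: xi2 yj2; rewrite xy; lia.
Qed.

Lemma entry_neq_opp n (w : {perm letter n}) i j : w \in Bgrp n ->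
  (0 < i < j)%N -> (j <= n)%N -> entry w i%:Z != - entry w j%:Z.
Proof.
move=> wB ij jn; rewrite -entryN //.
have /lval_pos[x xi xi2] : (0 < i <= n)%N by lia.
have /lval_pos[y yj yj2] : (0 < j <= n)%N by lia.
rewrite -xi -yj -lval_neg !entry_lval; apply/eqP => /lval_inj /perm_inj xy.
by move: xi2 yj2; rewrite xy /=; lia.
Qed.

(** * The longest element *)

(** The second component [0] is that of the letters [1] and [-1], whose sign is
kept when [n] is odd; this makes the number of sign changes even. *)
Definition w0_fun n (x : letter n) : letter n :=
  (x.1 (+) ~~ (odd n && (x.2 == 0%N :> nat)), x.2).

Lemma w0_funK n : involutive (@w0_fun n).
Proof. by case=> b i; rewrite /w0_fun /= -addbA addbb addbF. Qed.

Definition w0 n : {perm letter n} := perm (can_inj (w0_funK n)).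

Lemma w0_mulK n : involutive (fun w : {perm letter n} => (w0 n * w)%g).
Proof.
by move=> w; apply/permP => x; rewrite !permM !permE w0_funK.
Qed.

Lemma w0_mulB n (w : {perm letter n}) : w \in Bgrp n -> (w0 n * w)%g \in Bgrp n.
Proof.
rewrite !inE => /forallP wB; apply/forallP => x.
rewrite !permM !permE -(eqP (wB _)); apply/eqP; congr (w _).
by rewrite /w0_fun /lneg /= addNb.
Qed.

Lemma entry_w0 n (w : {perm letter n}) (i : nat) : w \in Bgrp n ->
  entry (w0 n * w)%g i%:Z =
  (-1) ^+ (~~ (odd n && (i == 1%N))) * entry w i%:Z.
Proof.
move=> wB; have [i_in|i_out] := boolP (0 < i <= n)%N; last first.
  (* Outside the range of the indices both entries are [0]. *)
  have no (x : letter n) : (lval x == i%:Z) = false.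
    have := ltn_ord x.2; rewrite /lval.
    by case: x => [[] k] /=; rewrite ?expr1 ?expr0 ?mulN1r ?mul1r; lia.
  by rewrite /entry; case: pickP => [x|_]; rewrite ?no // mulr0.
have [x xi xi2] := lval_pos _ _ i_in.
rewrite -xi !entry_lval permM permE -xi2 eqSS.
have -> : w0_fun _ x = if odd n && (x.2 == 0%N :> nat) then x else lneg x.
  rewrite /w0_fun; case: (odd n && _); case: x {xi xi2} => b k /=.
    by rewrite addbF.
  by rewrite addbT.
move: wB; rewrite inE => /forallP wB.
case: ifP => _; rewrite ?expr0 ?mul1r ?expr1 ?mulN1r //.
by rewrite (eqP (wB x)) lval_neg.
Qed.

Lemma entry_w0_ge2 n (w : {perm letter n}) (i : nat) : w \in Bgrp n ->
  (1 < i)%N -> entry (w0 n * w)%g i%:Z = - entry w i%:Z.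
Proof.
by move=> wB i1; rewrite entry_w0 // (gtn_eqF i1) andbF expr1 mulN1r.
Qed.

(** The entries [w_2, ..., w_n] change sign and [w_1] does so when [n] is even:
an even number of sign changes for either parity of [n]. *)
Lemma odd_nneg_w0 n (w : {perm letter n}) : w \in Bgrp n ->
  odd (nneg (w0 n * w)%g) = odd (nneg w).
Proof.
case: n w => [//|n] w wB; rewrite /nneg /=.
have rest : (count (fun i : nat => entry w i%:Z < 0)%R (iota 2 n) +
    count (fun i : nat => entry (w0 n.+1 * w)%g i%:Z < 0)%R (iota 2 n))%N = n.
  rewrite -[RHS](size_iota 2) -[RHS]count_predT.
  apply: (count_pred_compl _ predT) => i; rewrite mem_iota => i_in.
  have := entry_neq0 _ w i; rewrite entry_w0_ge2 //; lia.
have := entry_neq0 _ w 1%N isT.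
rewrite entry_w0 // eqxx andbT /= negbK.
by case: (boolP (odd n)) => odd_n; rewrite ?expr1 ?expr0 ?mulN1r ?mul1r; lia.
Qed.

Lemma w0_mulD n (w : {perm letter n}) : w \in Dgrp n -> (w0 n * w)%g \in Dgrp n.
Proof.
by move=> /setIdP[wB w_even]; apply/setIdP; rewrite w0_mulB // odd_nneg_w0.
Qed.

(** * Complementary statistics *)

Lemma pair_count_w0 n (w : {perm letter n}) (i j : nat) : w \in Bgrp n ->
  (0 < i < j)%N -> (j <= n)%N ->
  let w' := (w0 n * w)%g in
  (((entry w j%:Z < entry w i%:Z)%R + (entry w j%:Z < - entry w i%:Z)%R) +
   ((entry w' j%:Z < entry w' i%:Z)%R + (entry w' j%:Z < - entry w' i%:Z)%R))%N
  = 2%N.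
Proof.
move=> wB ij jn w'; rewrite /w' (@entry_w0_ge2 _ _ j) ?(@entry_w0 _ _ i) //; last lia.
by apply: opp_pair_count; [apply: entry_neq | apply: entry_neq_opp].
Qed.

Lemma invD_w0 n (w : {perm letter n}) : w \in Bgrp n ->
  (invD w + invD (w0 n * w)%g)%N = (n * (n - 1))%N.
Proof.
move=> wB; have invE (v : {perm letter n}) : invD v =
    (\sum_(p : 'I_n.+1 * 'I_n.+1 | 0 < p.1 < p.2)
      ((entry v p.2%:Z < entry v p.1%:Z)%R +
       (entry v p.2%:Z < - entry v p.1%:Z)%R))%N.
  rewrite /invD -!sum1dep_card big_split !big_mkcondr /=.
  by congr (_ + _)%N; apply: eq_bigr => p _; case: (_ < _)%R.
rewrite !invE -big_split /= (eq_bigr (fun=> 2%N)) => [|[i j] /= ij]; last first.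
  by apply: pair_count_w0 => //; rewrite -ltnS.
rewrite sum_nat_cond_const; move: (card_pos_pairs n); rewrite cardsE => ->.
by case: n {w wB invE} => // n; rewrite bin2 subn1 muln2 halfK oddM /= andNb subn0.
Qed.

Lemma Ddescent_w0 n (w : {perm letter n}) (i : nat) : w \in Bgrp n ->
  (1 < i < n)%N -> Ddescent (w0 n * w)%g i%:Z = ~~ Ddescent w i%:Z.
Proof.
move=> wB i_in; have [i1 i_n] := andP i_in.
rewrite /Ddescent absz_nat !entry_w0_ge2 //; last exact: ltnW.
have := entry_neq _ w i i.+1 _ i_n; rewrite ltnSn ltnW // => /(_ isT).
lia.
Qed.

(** The indices [-1] and [1] compare [w_2] with [- w_1] and [w_1], so these are
the four comparisons made for the pair [1, 2]. When [n] is odd, [-1] and [1]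
exchange their roles, so that neither has complementary descents by itself. *)
Lemma Ddescent_w0_pm1 n (w : {perm letter n}) : w \in Bgrp n -> (1 < n)%N ->
  ((Ddescent w (-1) + Ddescent w 1) +
   (Ddescent (w0 n * w)%g (-1) + Ddescent (w0 n * w)%g 1))%N = 2%N.
Proof.
move=> wB n1; have := pair_count_w0 _ w 1 2 wB isT n1.
by rewrite /Ddescent /= !entryN ?w0_mulB // !(addnC (nat_of_bool (_ < - _)%R)).
Qed.

Lemma odesDE n (w : {perm letter n.+2}) :
  odesD w = (Ddescent w (-1) + Ddescent w 1 +
    count (fun i : nat => odd i && Ddescent w i%:Z) (iota 2 n))%N.
Proof. by rewrite /odesD /= count_map addnA. Qed.

Lemma edesDE n (w : {perm letter n.+2}) :
  edesD w = count (fun i : nat => ~~ odd i && Ddescent w i%:Z) (iota 2 n).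
Proof. by rewrite /edesD /= count_map. Qed.

Lemma odesD_w0 n (w : {perm letter n}) : w \in Bgrp n -> (1 < n)%N ->
  (odesD w + odesD (w0 n * w)%g)%N = (n./2).+1.
Proof.
case: n w => [//|[//|n]] w wB n1; have pm1 := Ddescent_w0_pm1 _ w wB n1.
have rest := count_pred_compl _ odd (fun i : nat => Ddescent w i%:Z)
  (fun i : nat => Ddescent (w0 n.+2 * w)%g i%:Z) (iota 2 n).
have := count_odd_iota n.+1; rewrite /= -rest => [|i]; last first.
  by rewrite mem_iota => i_in; apply: Ddescent_w0 => //; lia.
by rewrite !odesDE addnACA pm1 => <-.
Qed.

Lemma edesD_w0 n (w : {perm letter n}) : w \in Bgrp n -> (1 < n)%N ->
  (edesD w + edesD (w0 n * w)%g)%N = (n.-1)./2.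
Proof.
case: n w => [//|[//|n]] w wB _.
rewrite !edesDE -(count_even_iota n.+1) /= add0n.
apply: (count_pred_compl _ (fun i => ~~ odd i)) => i; rewrite mem_iota => i_in.
by apply: Ddescent_w0 => //; lia.
Qed.

(** * The symmetry *)

Lemma expr_compl (R : comUnitRingType) (x : R) (a b m : nat) :
  x \is a GRing.unit -> (a + b)%N = m -> x ^+ a = x ^+ m * x^-1 ^+ b.
Proof. by move=> ux <-; rewrite exprD exprVn mulrK // unitrX. Qed.

(** There are [n./2 + 1] odd indices (with [-1]) and [(n - 1)./2] even ones,
which gives both parities of [n] at once. The reindexing puts [w \o w0] on the
left, so each exponent there is the total minus the statistic of [w]. *)
Lemma Dpoly_reciprocal (R : comUnitRingType) (s t q : R) n :
  s \is a GRing.unit -> t \is a GRing.unit -> q \is a GRing.unit -> (1 < n)%N ->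
  Dpoly n s t q = q ^+ (n * (n - 1)) * s ^+ (n.-1)./2 * t ^+ (n./2).+1 *
                  Dpoly n s^-1 t^-1 q^-1.
Proof.
move=> us ut uq n1.
rewrite /Dpoly big_distrr /= (reindex_inj (inv_inj (w0_mulK n))) /=.
apply: eq_big => [w|w /w0_mulD]; rewrite ?w0_mulK.
  by apply/idP/idP => /w0_mulD; rewrite ?w0_mulK.
move=> /setIdP[wB _].
rewrite (expr_compl _ s _ _ _ us (etrans (addnC _ _) (edesD_w0 _ w wB n1))).
rewrite (expr_compl _ t _ _ _ ut (etrans (addnC _ _) (odesD_w0 _ w wB n1))).
rewrite (expr_compl _ q _ _ _ uq (etrans (addnC _ _) (invD_w0 _ w wB))).
ring.
Qed.

Theorem corollary37 (R : comUnitRingType) (s t q : R)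
    (hs : s \is a GRing.unit) (ht : t \is a GRing.unit)
    (hq : q \is a GRing.unit) (n : nat) (hn : (2 <= n)%N) :
  (forall k : nat, n = (2 * k + 1)%N ->
     Dpoly n s t q =
     q ^+ (n * (n - 1)) * s ^+ k * t ^+ (k + 1) * Dpoly n s^-1 t^-1 q^-1) /\
  (forall k : nat, n = (2 * k)%N ->
     Dpoly n s t q =
     q ^+ (n * (n - 1)) * s ^+ (k - 1) * t ^+ (k + 1) * Dpoly n s^-1 t^-1 q^-1).
Proof.
rewrite Dpoly_reciprocal //; split=> k nE.
  by have [-> ->] : (n.-1)./2 = k /\ (n./2).+1 = (k + 1)%N by lia.
by have [-> ->] : (n.-1)./2 = (k - 1)%N /\ (n./2).+1 = (k + 1)%N by lia.
Qed.
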